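(* Let $G$ be a topological group, and let $\kappa > 0$ be a cardinal. Suppose that $G$ contains a free subgroup $F$ of rank $\kappa$ such that $F\setminus \{1\}$ is dense in $G$. Then $G$ is almost $\kappa$-free. Moreover, if $2 \leq \kappa \leq \aleph_0$, then $G$ is almost countably free.
   Context: Topological groups are not assumed to be Hausdorff. For a cardinal $\kappa>0$ and a group $G$, let $G_\kappa$ denote the set of $\kappa$-tuples $(g_i)_{i\in\kappa}\in G^\kappa$ that freely generate a free subgroup of $G$, i.e. such that no nontrivial reduced group word in the indexed variables $(x_i)_{i\in\kappa}$ evaluates to $1$ at $(g_i)_{i\in\kappa}$ (equivalently, the homomorphism from the free group on $\{x_i\}_{i\in\kappa}$ to $G$ sending $x_i\mapsto g_i$ is injective). An infinite topological group $G$ is called almost $\kappa$-free if $G_\kappa$ is dense in $G^\kappa$ with the product topology (a finite topological group is not almost $\kappa$-free). ''Almost countably free'' means almost $\aleph_0$-free. *)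

(* Defs.v *)
From HB Require Import structures.
From mathcomp Require Import all_boot.
From mathcomp Require Import boolp classical_sets functions cardinality.
From mathcomp Require Import topology.

Set Implicit Arguments.
Unset Strict Implicit.
Unset Printing Implicit Defensive.

Local Open Scope classical_set_scope.
Local Open Scope group_scope.

#[short(type="preTopologicalGroupType")]
HB.structure Definition PreTopologicalGroup :=
  {G of Topological G & Group G}.

HB.mixin Record PreTopologicalGroup_isTopologicalGroup G
    of PreTopologicalGroup G := {
  mulg_continuous : continuous (fun x : G * G => x.1 * x.2) ;
  invg_continuous : continuous (fun x : G => x^-1) ;
}.

(* No separation axiom is assumed. *)
#[short(type="topologicalGroupType")]
HB.structure Definition TopologicalGroup :=
  {G of PreTopologicalGroup_isTopologicalGroup G & PreTopologicalGroup G}.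

(* Cardinals are represented by types: the tuples indexed by a cardinal kappa
   are the functions on a type K of cardinality kappa. *)

(* A group word in the variables indexed by K: the letter (i, false) stands
   for the variable of index i, and (i, true) for its formal inverse. *)
Definition gword (K : Type) := seq (K * bool).

Definition reduced_gword (K : Type) (w : gword K) : Prop :=
  forall (u v : gword K) (i : K) (b : bool),
    w <> u ++ [:: (i, b), (i, ~~ b) & v].

Definition eval_gword (K : Type) (G : groupType) (g : K -> G) (w : gword K) :
    G :=
  \prod_(l <- w) (if l.2 then (g l.1)^-1 else g l.1).

Definition freely_generates (K : Type) (G : groupType) (g : K -> G) : Prop :=
  forall w : gword K, reduced_gword w -> w <> [::] -> eval_gword g w <> 1.

Definition is_subgroup (G : groupType) (A : set G) : Prop :=
  [/\ A 1, (forall x y, A x -> A y -> A (x * y)) &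
      (forall x, A x -> A x^-1)].

Definition generated_subgroup (G : groupType) (S : set G) : set G :=
  smallest (@is_subgroup G) S.

Definition is_free_subgroup_of_rank (K : Type) (G : groupType) (F : set G) :
    Prop :=
  exists2 f : K -> G, freely_generates f & F = generated_subgroup (range f).

Definition free_tuples (K : Type) (G : topologicalGroupType) :
    set {ptws K -> G} :=
  [set g | freely_generates g].

Definition almost_free (K : Type) (G : topologicalGroupType) : Prop :=
  infinite_set [set: G] /\ dense (@free_tuples K G).

Definition almost_countably_free (G : topologicalGroupType) : Prop :=
  almost_free nat G.

(* Main.v *)
(* Write F = <g> and suppose g has two distinct members g_k0, g_k1.  Given
   nonempty open sets U_n, n < N, density provides nontrivial f_n in F with f_n
   in U_n.  For letters x, y over {k0, k1} and exponents m_n spaced widely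
   compared with the lengths of the f_n, put c_n = x^(m_n) y.  The elements
   h_n = f_n c_n w c_n^-1 lie in U_n as soon as w is close enough to 1, and such
   a w exists in F \ {1}.  Since the c_n range over finitely many elements
   chosen before w, y can be selected afterwards so that y w y^-1 is reduced;
   then f_n c_n and c_n reduce to words none of which is a prefix of another,
   because f_n <> 1, and ping-pong on reduced words shows that the h_n are free.
   The elements c (g_k)^2 c^-1, with c = x^m y for one more exponent m and k
   different from k0 and k1, can be adjoined to the h_n: they fill the
   unconstrained coordinates.  When g has a single member, every nontrivial
   element of F has infinite order. *)

Require Import Defs.
From mathcomp Require Import all_boot zify.
From mathcomp Require Import boolp classical_sets functions cardinality.
From mathcomp Require Import topology.

Set Implicit Arguments.
Unset Strict Implicit.
Unset Printing Implicit Defensive.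

Local Open Scope classical_set_scope.
Local Open Scope group_scope.

(** * Reduced words, their evaluation, and ping-pong *)

Section Words.
Variable K : eqType.
Implicit Types (l x y : K * bool) (w u v d : gword K).

Definition linv l : K * bool := (l.1, ~~ l.2).

Lemma linvK : involutive linv.
Proof. by case=> i b; rewrite /linv /= negbK. Qed.

Lemma neq_linv l : l != linv l.
Proof. by case: l => i [] /=; rewrite /linv /= xpair_eqE eqxx. Qed.

Definition winv w : gword K := rev (map linv w).

Lemma winv_cons l w : winv (l :: w) = rcons (winv w) (linv l).
Proof. by rewrite /winv /= rev_cons. Qed.

Lemma winv_rcons w l : winv (rcons w l) = linv l :: winv w.
Proof. by rewrite /winv map_rcons rev_rcons. Qed.

(** A boolean form of [reduced_gword], stated through [sorted] so that results on sorted sequences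
    apply. *)
Definition red w := sorted (fun a b => b != linv a) w.

Lemma redP w : reduced_gword w <-> red w.
Proof.
split=> [rw | rw u v i b E]; last first.
  move: rw; rewrite E /red sorted_cat_cons /= => /and3P[_ + _].
  by rewrite /linv /= eqxx.
elim: w rw => //= -[i b] [|b' w] IH rw //=; apply/andP; split.
  by apply/eqP=> E; apply: (rw [::] w i b); rewrite E.
by apply: IH => u v j e E; apply: (rw ((i, b) :: u) v j e); rewrite E.
Qed.

Lemma red_cat u v : red u -> red v ->
  (forall a b u' v', u = rcons u' a -> v = b :: v' -> b != linv a) ->
  red (u ++ v).
Proof.
case: v => [|b v]; first by rewrite cats0.
case/lastP: u => [|u a] // ru rv /(_ a b u v erefl erefl) ab.
by rewrite cat_rcons /red sorted_cat_cons; apply/andP; split; rewrite //= ab.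
Qed.

Lemma red_catl u v : red (u ++ v) -> red u.
Proof. by move=> /cat_sorted2[]. Qed.

Lemma red_catr u v : red (u ++ v) -> red v.
Proof. by move=> /cat_sorted2[]. Qed.

Lemma red_winv w : red w -> red (winv w).
Proof.
rewrite /red /winv rev_sorted sorted_map.
apply: sub_sorted => a b; apply: contraNN => /eqP/(can_inj linvK) ->.
by rewrite linvK.
Qed.

Lemma red_nseq n l : red (nseq n l).
Proof. by elim: n => // -[|n] //= ->; rewrite neq_linv. Qed.

Section Eval.
Variables (G : groupType) (g : K -> G).

Lemma eval_nil : eval_gword g [::] = 1.
Proof. by rewrite /eval_gword big_nil. Qed.

Lemma eval_cat u v : eval_gword g (u ++ v) = eval_gword g u * eval_gword g v.
Proof. by rewrite /eval_gword big_cat. Qed.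

Lemma eval_cons l w :
  eval_gword g (l :: w) = eval_gword g [:: l] * eval_gword g w.
Proof. by rewrite -cat1s eval_cat. Qed.

Lemma eval_linv l : eval_gword g [:: linv l] = (eval_gword g [:: l])^-1.
Proof.
by case: l => i []; rewrite /eval_gword !big_seq1 /=; rewrite ?invgK.
Qed.

Lemma eval_winv w : eval_gword g (winv w) = (eval_gword g w)^-1.
Proof.
elim: w => [|l w IH]; first by rewrite eval_nil invg1.
by rewrite winv_cons -cats1 eval_cat IH eval_linv (eval_cons l w) invgM.
Qed.

Lemma eval_red w : exists2 w', red w' & eval_gword g w' = eval_gword g w.
Proof.
elim: w => [|l w [w' rw' E]]; first by exists [::].
case: w' rw' E => [|a w'] rw' E.
  by exists [:: l] => //; rewrite (eval_cons l w) -E eval_nil mulg1.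
have [al|al] := eqVneq a (linv l); last first.
  by exists (l :: a :: w'); [rewrite /= al|rewrite (eval_cons l w) -E -eval_cons].
exists w'; first by apply: (@red_catr [:: a]).
by rewrite (eval_cons l w) -E (eval_cons a w') al eval_linv mulVKg.
Qed.

Lemma generated_eval :
  generated_subgroup (range g) `<=` range (@eval_gword K G g).
Proof.
apply: smallest_sub => [|_ [k _ <-]].
  split=> [|_ _ [u _ <-] [v _ <-]|_ [u _ <-]].
  - by exists [::]; rewrite ?eval_nil.
  - by exists (u ++ v); rewrite ?eval_cat.
  - by exists (winv u); rewrite ?eval_winv.
by exists [:: (k, false)] => //; rewrite /eval_gword big_seq1.
Qed.

(** Since [v] does not start with [p], cancellation in [winv p ++ v] stops before it consumes
    [winv p]. The first letter of [winv p] survives, so [u] can still precede the result. *)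
Lemma cancel_winv u p v : red p -> red (u ++ winv p) -> red v ->
  (forall r, v <> p ++ r) ->
  exists2 z, red (u ++ z) & eval_gword g z = (eval_gword g p)^-1 * eval_gword g v.
Proof.
elim: p v => [|a p IH] v rp ru rv vp; first by case: (vp v).
rewrite winv_cons in ru.
case: v rv vp => [|b v] rv vp.
  by exists (winv (a :: p)); rewrite ?winv_cons // -winv_cons eval_winv eval_nil mulg1.
have [ba|ba] := eqVneq b a.
  have [] := IH v.
  - exact: (@red_catr [:: a]).
  - by move: ru; rewrite -cats1 catA; apply: red_catl.
  - exact: (@red_catr [:: b]).
  - by move=> r E; apply: (vp r); rewrite E ba.
  move=> z rz Ez; exists z => //.
  by rewrite Ez ba (eval_cons a p) (eval_cons a v) invgM -mulgA mulKg.
exists (winv (a :: p) ++ b :: v); last by rewrite eval_cat eval_winv.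
rewrite winv_cons catA; apply: red_cat => // c e u' v'.
by rewrite -rcons_cat => /rcons_inj[_ <-] [<- _]; rewrite linvK.
Qed.

(* Ping-pong on the Cayley tree: h_j maps the complement of the set of reduced
   words starting with p (j, true) into the words starting with p (j, false),
   and symmetrically for its inverse. *)
Lemma pingpong (J : Type) (p : J * bool -> gword K) (m : J -> gword K) :
  freely_generates g ->
  (forall l : J * bool, p l <> [::]) ->
  (forall (l l' : J * bool) r r', p l ++ r = p l' ++ r' -> l = l') ->
  (forall j, red (p (j, false) ++ m j ++ winv (p (j, true)))) ->
  freely_generates
    (fun j => eval_gword g (p (j, false) ++ m j ++ winv (p (j, true)))).
Proof.
move=> fg p0 pp rW; set h := fun j => _.
have rp (l : J * bool) : red (p l).
  case: l => j [].
  - have := red_winv (red_catr (red_catr (rW j))).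
    by rewrite /winv map_rev revK mapK //; exact: linvK.
  - exact: (red_catl (rW j)).
(* The inverse of [h j] has the same shape with the two prefixes exchanged, so both signs of a
   letter are treated alike. *)
have rW' (l : J * bool) : exists2 M, red (p l ++ M ++ winv (p (l.1, ~~ l.2))) &
    eval_gword g (p l ++ M ++ winv (p (l.1, ~~ l.2))) = eval_gword h [:: l].
  case: l => j [] /=; last first.
    by exists (m j) => //; rewrite {2}/eval_gword big_seq1.
  exists (winv (m j)).
    have := red_winv (rW j).
    by rewrite /winv !map_cat !rev_cat map_rev revK mapK -?catA //; exact: linvK.
  by rewrite [RHS]/eval_gword big_seq1 /= /h !eval_cat !eval_winv !invgM !invgK mulgA.
(* The invariant is that the reduced form of the value of [v] starts with the prefix attached to the
   first letter of [v]. *)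
have key (v : gword J) : reduced_gword v ->
    exists X, [/\ red X, eval_gword g X = eval_gword h v, (v = [::] -> X = [::]) &
      forall (l : J * bool) (v' : gword J), v = l :: v' -> exists r, X = p l ++ r].
  elim: v => [|l v IH] rv; first by exists [::]; rewrite /eval_gword !big_nil.
  have [|X [rX EX X0 Xp]] := IH.
    by move=> u v' i b E; apply: (rv (l :: u) v' i b); rewrite E.
  have [M rM EM] := rW' l.
  have [|r E|z rz Ez] := @cancel_winv (p l ++ M) (p (l.1, ~~ l.2)) X (rp _) _ rX; first by rewrite -catA.
  (* If [X] started with the prefix of the inverse of [l], that inverse would be the next letter of
     the word, which is reduced. *)
  - case: v rv X0 Xp {IH EX} => [|l' v] rv X0 Xp.
      by move: E; rewrite X0 //; case: (p _) (p0 (l.1, ~~ l.2)).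
    have [r' E'] := Xp l' v erefl.
    have El := pp _ _ _ _ (etrans (esym E') E).
    by case: l rv El {rM EM E} => i b rv El; apply: (rv [::] v i b); rewrite El.
  - exists ((p l ++ M) ++ z); split=> //.
      rewrite eval_cat Ez (_ : eval_gword h (l :: v) = eval_gword h [:: l] * eval_gword h v).
        by rewrite -EM -EX !eval_cat eval_winv !mulgA.
      by rewrite /eval_gword !big_cons big_nil mulg1.
    by move=> l' v' [<- _]; exists (M ++ z); rewrite catA.
move=> v rv v0; have [X [rX EX _ Xp]] := key v rv.
rewrite -EX; apply: fg; first exact/redP.
case: v v0 Xp {rv EX} => // l v _ /(_ l v erefl) [r ->].
by case: (p l) (p0 l).
Qed.

End Eval.
End Words.

Lemma red_glue (K : eqType) (u v : gword K) a :
  red (rcons u a) -> red (a :: v) -> red (rcons u a ++ v).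
Proof. by move=> ru rv; rewrite cat_rcons /red sorted_cat_cons; apply/andP. Qed.

(** * Construction of the free family from conjugates *)

Section FreeFamily.
Variables (K : eqType) (x y : K * bool).
Implicit Types w d f r : gword K.

(** If, say, [d'] were strictly longer than [d], its last letter would fall inside the run
    [nseq M x] and be [x], which is excluded. Once [d = d'], the letter [y] marks the end of each
    run. *)
Lemma run_word_inj d d' M M' r r' : y != x ->
  (forall u, d <> rcons u x) -> (forall u, d' <> rcons u x) ->
  (size d <= M')%N -> (size d' <= M)%N ->
  d ++ nseq M x ++ y :: r = d' ++ nseq M' x ++ y :: r' ->
  [/\ d = d', M = M' & r = r'].
Proof.
move=> yx.
have E0 N N' (s s' : gword K) : nseq N x ++ y :: s = nseq N' x ++ y :: s' ->
    N = N' /\ s = s'.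
  elim: N N' => [|N IH] [|N'] //= [].
  - by [].
  - by move=> E; rewrite E eqxx in yx.
  - by move=> E; rewrite E eqxx in yx.
  - by move=> /IH[-> ->].
wlog dd : d d' M M' r r' / (size d <= size d')%N.
  move=> H dx dx' dM dM' E; case/orP: (leq_total (size d) (size d')) => dd.
    exact: H dd dx dx' dM dM' E.
  by have [-> -> ->] := H _ _ _ _ _ _ dd dx' dx dM' dM (esym E).
move=> _ dx' _ dM' E.
have [e De] : exists e, d' = d ++ e.
  exists (drop (size d) d'); rewrite -[LHS](cat_take_drop (size d)); congr (_ ++ _).
  have := congr1 (take (size d)) E.
  by rewrite take_size_cat // takel_cat // => ->.
move: dM' dx' E; rewrite {}De {dd} => eM dx'.
rewrite -catA => /eqP; rewrite eqseq_cat // eqxx /= => /eqP E.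
case/lastP: e eM dx' E => [|e a] eM dx' E.
  by rewrite cats0; have [-> ->] := E0 _ _ _ _ E.
exfalso; apply: (dx' (d ++ e)); rewrite -rcons_cat; congr rcons.
have sM : (size e < M)%N by move: eM; rewrite size_cat size_rcons; lia.
have := congr1 (nth y ^~ (size e)) E.
rewrite nth_cat size_nseq sM nth_nseq sM => ->.
by rewrite nth_cat size_rcons ltnSn nth_rcons ltnn eqxx.
Qed.

Variables (G : groupType) (g : K -> G).
Local Notation ev := (eval_gword g).

(* dj = (d, j), where d is f without its final run of letters x^(+-1); this run
   contributes to x^m the signed exponent j - size f. *)
Lemma absorb_run f : red f -> exists dj : gword K * nat,
  [/\ red dj.1, (size dj.1 <= size f)%N, (dj.2 <= 2 * size f)%N,
      (forall u l, dj.1 = rcons u l -> l.1 != x.1) &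
      forall m, (size f <= m)%N ->
        ev (f ++ nseq m x) = ev (dj.1 ++ nseq (m + dj.2 - size f) x)].
Proof.
elim/last_ind: f => [|f l IH] rf.
  exists ([::], 0%N); split=> // [[]//|m _].
  by rewrite /= addn0 subn0.
have [lx|lx] := eqVneq l.1 x.1; last first.
  exists (rcons f l, size (rcons f l)); split=> //=; first by lia.
    by move=> u a /rcons_inj[_ <-].
  by move=> m fm; rewrite addnK.
have [|[d j] /= [rd sd sj dx E]] := IH; first by move: rf; rewrite -cats1; apply: red_catl.
have [lx'|lx'] := eqVneq l x.
  exists (d, j.+2); split=> //=; rewrite ?size_rcons; try lia.
  move=> m fm; rewrite cat_rcons lx' -[x :: _]/(nseq m.+1 x) E; last by lia.
  by congr (ev (_ ++ nseq _ _)); lia.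
exists (d, j); split=> //=; rewrite ?size_rcons; try lia.
move=> [|m] fm; first by lia.
rewrite cat_rcons eval_cat (eval_cons _ l) (eval_cons _ x) -/(nseq m x).
have -> : l = linv x.
  by case: l lx lx' {rf} => i b /= ->; case: x => k [] /=; case: b; rewrite ?eqxx.
rewrite eval_linv mulKg -eval_cat E; last by lia.
by congr (ev (_ ++ nseq _ _)); lia.
Qed.

(* Distinct values are more than 2 L apart, so that they stay distinct after
   shifts by at most L. *)
Definition spaced L n := ((2 * L).+1 * n.+1)%N.

Definition conjugator m : gword K := rcons (nseq m x) y.

Lemma free_family w (f : nat -> gword K) L :
  freely_generates g -> x.1 != y.1 -> red (y :: rcons w (linv y)) ->
  (forall n, [/\ red (f n), (size (f n) <= L)%N & ev (f n) <> 1]) ->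
  freely_generates
    (fun j : nat + {k : K | (k != x.1) && (k != y.1)} =>
     match j with
     | inl n => let c := ev (conjugator (spaced L n.+1)) in
                ev (f n) * c * ev w * c^-1
     | inr k => let c := ev (conjugator (spaced L 0)) in
                c * g (val k) * g (val k) * c^-1
     end).
Proof.
move=> fg xy rw /all_and3[rf sf f1].
have Es n : (spaced L n = n * (2 * L).+1 + (2 * L).+1)%N.
  by rewrite /spaced mulnC mulSn addnC.
move: (spaced L) Es => s Es.
have yx : y != x by apply: contraNneq xy => ->.
have [dj Edj] := choice (fun n => absorb_run (rf n)).
pose M n := (s n.+1 + (dj n).2 - size (f n))%N.
(* A triple gives a stem, an exponent of [x], and a tail after [y]. For [inl n] the two signs encode
   the reduced forms of [f n] times the conjugator and of the conjugator alone. For [inr k] the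
   square is split in the middle: each prefix takes one letter, [(k, true)] reappearing inverted,
   and the middle word is empty. Exponent [s 0] is reserved for this case. *)
pose t (l : (nat + {k : K | (k != x.1) && (k != y.1)}) * bool) := match l with
  | (inl n, false) => ((dj n).1, M n, [::])
  | (inl n, true) => ([::], s n.+1, [::])
  | (inr k, b) => ([::], s 0, [:: (val k, b)])
  end.
pose p l := (t l).1.1 ++ nseq (t l).1.2 x ++ y :: (t l).2.
pose m (j : nat + {k : K | (k != x.1) && (k != y.1)}) :=
  match j with inl n => w | inr k => [::] end.
have divE q a b : (a <= 2 * L)%N ->
    b = (q * (2 * L).+1 + a)%N -> (b %/ (2 * L).+1 = q)%N.
  by move=> aL ->; rewrite divnMDl // divn_small ?addn0.
(* The subtraction in [M n] is not truncated, because [size (f n) <= L < s n.+1]. *)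
have ME n : [/\ (dj n).2 <= 2 * size (f n), size (f n) <= L &
    M n + size (f n) = s n.+1 + (dj n).2]%N.
  have [_ _ sj _ _] := Edj n; split=> //; rewrite /M.
  by rewrite subnK // Es; have := sf n; lia.
(* Every exponent differs from its nominal value by at most [L], so adding [L] and dividing by the
   spacing recovers the index. *)
have qE l : (((t l).1.2 + L) %/ (2 * L).+1 =
    match l.1 with inl n => n.+2 | inr _ => 1 end)%N.
  case: l => -[n|k] [] /=.
  - by apply: (divE _ L); [lia|rewrite Es; lia].
  - have [h1 h2 h3] := ME n; apply: (divE _ ((dj n).2 + L - size (f n))%N); first by lia.
    by rewrite Es in h3; lia.
  - by apply: (divE _ L); [lia|rewrite Es; lia].
  - by apply: (divE _ L); [lia|rewrite Es; lia].
have tL l : [/\ (size (t l).1.1 <= L)%N, (L < (t l).1.2)%N &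
    forall u, (t l).1.1 <> rcons u x].
  case: l => -[n|k] [] /=; split=> //=; rewrite ?Es; try lia; try by case.
  - by have [_ + _ _ _] := Edj n; have := sf n; lia.
  - by have [h1 h2 h3] := ME n; rewrite Es in h3; lia.
  - by move=> u E; have [_ _ _ /(_ u x E)] := Edj n; rewrite eqxx.
have p0 l : p l <> [::] by rewrite /p; case: (t l).1.1 => //; case: (t l).1.2.
have nS n : nseq n x ++ [:: y] = conjugator n by rewrite /conjugator cats1.
(* Otherwise f n c_n and c_n would be equal in G. *)
have mt n : [/\ (dj n).1 = [::] & M n = s n.+1] -> False.
  case=> d0 Mn; apply: (f1 n); have [h1 h2 h3] := ME n.
  have [_ _ _ _ /(_ (s n.+1))] := Edj n.
  rewrite -/(M n) Mn d0 eval_cat => H; apply: (mulIg (ev (nseq (s n.+1) x))).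
  by rewrite H ?mul1g // Es; lia.
(* Equal exponents force equal indices. The sign is then decided by [mt] for [inl], and the tail
   decides both [k] and the sign for [inr]. *)
have pp l l' r r' : p l ++ r = p l' ++ r' -> l = l'.
  rewrite /p -!catA !cat_cons; have [a1 a2 a3] := tL l; have [b1 b2 b3] := tL l'.
  move=> /(run_word_inj yx a3 b3 (leq_trans a1 (ltnW b2)) (leq_trans b1 (ltnW a2)))[E1 E2 E3].
  have := qE l; rewrite E2 qE {a1 a2 a3 b1 b2 b3}.
  case: l E1 E2 E3 => -[n|k] b; case: l' => -[n'|k'] b' //= E1 E2 E3.
  - move=> [En]; move: E1 E2 E3; rewrite {}En.
    by case: b; case: b' => //= E1 E2 E3; case: (mt n).
  - by move: E3 => [/val_inj -> ->].
have redc n : (0 < n)%N -> red (conjugator n).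
  move=> n0; rewrite /conjugator -cats1; apply: red_cat => //; first exact: red_nseq.
  move=> a b u v E [<- _]; apply: contraNneq xy => ->.
  have : a \in nseq n x by rewrite E mem_rcons inE eqxx.
  by rewrite mem_nseq => /andP[_ /eqP ->].
have redc' n : red (winv (conjugator (s n))).
  by apply/red_winv/redc; rewrite Es; lia.
have rp n : red ((dj n).1 ++ conjugator (M n)).
  have [rd _ _ dx _] := Edj n.
  have M0 : (0 < M n)%N by have [_ + _] := tL (inl n, false); exact: leq_trans.
  apply: red_cat => //; first exact: redc.
  move=> a b u v /dx ax; rewrite /conjugator; case: (M n) M0 => //= N _ [<- _].
  by apply: contraNneq ax => ->.
have pinr k : p (inr k, false) ++ m (inr k) ++ winv (p (inr k, true)) =
    conjugator (s 0) ++ [:: (val k, false); (val k, false)] ++ winv (conjugator (s 0)).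
  have E b : p (inr k, b) = rcons (conjugator (s 0)) (val k, b).
    by rewrite /p /= /conjugator -!cats1 -catA.
  by rewrite !E winv_rcons -cats1 -catA.
have rW j : red (p (j, false) ++ m j ++ winv (p (j, true))).
  case: j => [n|k].
    rewrite /p /= !nS.
    rewrite /conjugator -rcons_cat; apply: red_glue.
      by rewrite rcons_cat; exact: rp.
    rewrite -cat_cons winv_rcons -cat_rcons; apply: red_glue => //.
    by rewrite -winv_rcons; exact: redc'.
  (* As [k] differs from [y.1], the middle letters cancel neither with [y] nor with its inverse. *)
  have /andP[kx ky] := valP k.
  rewrite pinr; apply: red_glue; first by apply: redc; rewrite Es; lia.
  have := redc' 0; rewrite winv_rcons /red /= => ->; rewrite neq_linv !andbT.
  by apply/andP; split; apply: contraNneq ky => /(congr1 fst)/= E; apply/eqP.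
have := pingpong fg p0 pp rW; congr freely_generates; apply/funext => -[n|k].
  have [_ _ _ _ /(_ (s n.+1))] := Edj n; rewrite -/(M n) => E; rewrite !eval_cat in E.
  rewrite /p /= !nS !eval_cat eval_winv !mulgA; congr (_ * _ * _^-1).
  rewrite /conjugator -!cats1 !eval_cat !mulgA E //.
  by have [h1 h2 h3] := ME n; rewrite Es; lia.
rewrite pinr !eval_cat eval_winv !mulgA (eval_cons _ (val k, false)) /eval_gword !big_seq1.
by rewrite !mulgA.
Qed.
End FreeFamily.

(** * Neighbourhoods and density in the product topology *)

Lemma ptws_box (I : eqType) (T : topologicalType) (g : {ptws I -> T})
    (O : set {ptws I -> T}) :
  nbhs g O -> exists (A : seq I) (U : I -> set T),
    (forall i, nbhs (g i) (U i)) /\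
    (forall h : {ptws I -> T}, (forall i, i \in A -> U i (h i)) -> O h).
Proof.
pose box : set_system {ptws I -> T} := fun Q =>
  exists (A : seq I) (U : I -> set T),
    (forall i, nbhs (g i) (U i)) /\
    (forall h : {ptws I -> T}, (forall i, i \in A -> U i (h i)) -> Q h).
have boxF : Filter box.
  split.
  - by exists [::], (fun=> setT); split=> // i; exact: filterT.
  - move=> P Q [A [U [gU UP]]] [B [V [gV VQ]]].
    exists (A ++ B), (fun i => U i `&` V i); split=> [i|h hUV]; first exact: filterI.
    split; [apply: UP|apply: VQ] => i iA; have [] := hUV i; rewrite // mem_cat iA //.
    by rewrite orbT.
  - by move=> P Q PQ [A [U [gU UP]]]; exists A, U; split=> // h /UP/PQ.
(* The product topology is the supremum of the topologies induced by the projections, so one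
   coordinate at a time suffices. *)
suff : cvg_to box (nbhs g) by apply.
apply/cvg_sup => i Q [_ [[W oW <-] Wg WQ]].
exists [:: i], (fun j => if j == i then W else setT); split=> [j|h hW].
  by case: eqP => [->|_]; [exact: open_nbhs_nbhs|exact: filterT].
by apply: WQ; have := hW i; rewrite inE eqxx; apply.
Qed.

Lemma dense_nbhs (T : topologicalType) (S : set T) (x : T) (A : set T) :
  dense S -> nbhs x A -> A `&` S !=set0.
Proof.
rewrite nbhsE => dS [O [oO Ox] OA].
by have [|z [Oz Sz]] := dS O _ oO; [exists x|exists z; split=> //; exact: OA].
Qed.

(** Only finitely many coordinates are constrained by a basic open set; [{classic J}] supplies the
    equality test for membership in [A]. *)
Lemma dense_free_tuples (J : Type) (G : topologicalGroupType) :
  (forall (A : seq {classic J}) (U : J -> set G),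
     (forall j, exists x : G, nbhs x (U j)) ->
     exists2 h : J -> G, freely_generates h &
       forall j : {classic J}, j \in A -> U j (h j)) ->
  dense (@free_tuples J G).
Proof.
move=> H O [g Og] oO.
have [A [U [gU UO]]] := @ptws_box {classic J} G g O (open_nbhs_nbhs (conj oO Og)).
have [|h fh hU] := H A U; first by move=> j; exists (g j).
by exists h; split=> //; exact: UO.
Qed.

(** * Reindexing, infinitude and rank one *)

Lemma freely_generates_comp (J J' : Type) (G : groupType) (h : J -> G)
    (i : J' -> J) :
  injective i -> freely_generates h -> freely_generates (h \o i).
Proof.
move=> ii fh v rv v0.
have <- : eval_gword h [seq (i l.1, l.2) | l <- v] = eval_gword (h \o i) v.
  by rewrite /eval_gword big_map.
apply: fh; last by case: v v0 {rv}.
have {}rv := (@redP {classic J'} v).1 rv.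
apply/(@redP {classic J}); rewrite /red sorted_map.
apply: sub_sorted rv => -[a b] [a' b'] /=; apply: contraNneq => -[/ii -> ->].
by rewrite eqxx.
Qed.

Lemma eval_nseq (K : eqType) (G : groupType) (g : K -> G) n l :
  eval_gword g (nseq n l) = eval_gword g [:: l] ^+ n.
Proof.
elim: n => [|n IH]; first by rewrite eval_nil.
by rewrite -[nseq _ _]/(l :: nseq n l) eval_cons IH expgS.
Qed.

(** The powers of a single generator are pairwise distinct. *)
Lemma free_infinite (K : eqType) (G : groupType) (g : K -> G) (k : K) :
  freely_generates g -> infinite_set [set: G].
Proof.
move=> fg fT; apply: infinite_nat.
pose e n := eval_gword g (nseq n (k, false)).
have ie : injective e.
  have le n m : e n = e m -> (n <= m)%N.
    move=> E; rewrite leqNgt; apply/negP => mn.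
    apply: (fg (nseq (n - m) (k, false))).
    - exact/redP/red_nseq.
    - by case: (n - m)%N (mn) (subn_gt0 m n) => // ->.
    apply: (mulIg (e m)); rewrite mul1g -[RHS]E /e -eval_cat.
    by rewrite -[_ ++ _]nseqD subnK // ltnW.
  by move=> n m E; apply/eqP; rewrite eqn_leq !le.
have := @inj_card_eq _ _ [set: nat] e (in2W ie) => /eq_finite_set <-.
by apply: sub_finite_set fT.
Qed.

Lemma red_subsingleton (K : eqType) (w : gword K) : (forall k k' : K, k = k') ->
  red w -> w <> [::] -> exists l n, w = nseq n.+1 l.
Proof.
move=> KK; case: w => // a w rw _; exists a, (size w); rewrite /=; congr (_ :: _).
elim: w a rw => //= b w IH a /andP[ab rw].
suff <- : b = a by rewrite -(IH b).
case: a b ab {rw} => k c [k' c'] /=; rewrite (KK k' k) /linv /= xpair_eqE eqxx /=.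
by case: c; case: c'.
Qed.

(** In rank one both [w] and [v] are powers of a letter, so substituting [w] into [v] gives a
    nonempty power of a letter again. *)
Lemma free_subsingleton (K : eqType) (G : groupType) (g : K -> G) w :
  (forall k k' : K, k = k') -> freely_generates g -> red w -> w <> [::] ->
  freely_generates (fun _ : K => eval_gword g w).
Proof.
move=> KK fg rw w0 v /redP rv v0.
have [a [m ->]] := red_subsingleton KK rw w0.
have [[k b] [n ->]] := red_subsingleton KK rv v0.
rewrite eval_nseq {1}/eval_gword big_seq1 /= -eval_winv.
have -> : winv (nseq m.+1 a) = nseq m.+1 (linv a).
  by rewrite /winv map_nseq rev_nseq.
have -> : (if b then eval_gword g (nseq m.+1 (linv a))
    else eval_gword g (nseq m.+1 a)) =
    eval_gword g (nseq m.+1 (if b then linv a else a)) by case: b {rv v0}.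
rewrite eval_nseq -expgnA -eval_nseq; apply: fg => //.
exact/redP/red_nseq.
Qed.

(* At most two letters y make y w y^-1 cancel, and there are three candidates. *)
Lemma noncancelling_letter (K : eqType) (k0 k1 : K) (w : gword K) :
  k0 != k1 -> red w -> w <> [::] ->
  exists b : bool * bool, let y := (if b.1 then k1 else k0, b.2) in
    red (y :: rcons w (linv y)).
Proof.
move=> k01 rw; case: w rw => // a w rw _.
have redy y : a != linv y -> y != last a w -> red (y :: rcons (a :: w) (linv y)).
  move=> ya yl; rewrite -cat1s /= ya /= rcons_path; apply/andP; split=> //.
  by rewrite (inj_eq (can_inj (@linvK K))).
have [E1|ne1] := eqVneq a (linv (k1, false)).
  have [E2|ne2] := eqVneq (last a w) (k0, false).
    exists (false, true); apply: redy; last by rewrite E2 xpair_eqE andbF.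
    by rewrite E1 xpair_eqE /= eq_sym (negbTE k01).
  exists (false, false); apply: redy; last by rewrite eq_sym.
  by rewrite E1 xpair_eqE /= eq_sym (negbTE k01).
have [E2|ne2] := eqVneq (last a w) (k1, false); last first.
  by exists (true, false); apply: redy => //; rewrite eq_sym.
have [E1|ne3] := eqVneq a (linv (k0, false)).
  exists (false, true); apply: redy; first by rewrite E1 xpair_eqE andbF.
  by rewrite E2 xpair_eqE (negbTE k01).
exists (false, false); apply: redy => //.
by rewrite E2 xpair_eqE (negbTE k01).
Qed.

(** * Perturbation by elements close to the identity *)

Lemma continuous_conjg (G : topologicalGroupType) (a b : G) (U : set G) :
  nbhs (a * b) U -> nbhs (1 : G) [set w | U (a * w * b)].
Proof.
move=> aU.
have mulc (u v : G) : z.1 * z.2 @[z --> (u, v)] --> u * v.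
  exact: (mulg_continuous (u, v)).
have ca : a * w @[w --> (1 : G)] --> a * 1.
  by apply: continuous2_cvg; [exact: mulc|exact: cvg_cst|exact: cvg_id].
have : a * w * b @[w --> (1 : G)] --> a * 1 * b.
  by apply: continuous2_cvg; [exact: mulc|exact: ca|exact: cvg_cst].
by rewrite mulg1; apply.
Qed.

Lemma dense_free_word (K : eqType) (G : topologicalGroupType) (g : K -> G)
    (F : set G) (x : G) (U : set G) :
  F = generated_subgroup (range g) -> dense (F `\ 1) -> nbhs x U ->
  exists w, [/\ red w, eval_gword g w <> 1 & U (eval_gword g w)].
Proof.
move=> -> dF /(dense_nbhs dF)[e [Ue [/generated_eval[w _ we] e1]]].
by have [w' rw' E] := eval_red g w; exists w'; rewrite E we.
Qed.

Lemma free_family_near (K : eqType) (G : topologicalGroupType) (g : K -> G)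
    (F : set G) (k0 k1 : K) (N : nat) (U : nat -> set G) :
  k0 != k1 -> freely_generates g -> F = generated_subgroup (range g) ->
  dense (F `\ 1) ->
  (forall n, exists x : G, nbhs x (U n)) ->
  exists x y : K * bool, exists h : nat + {k : K | (k != x.1) && (k != y.1)} -> G,
  [/\ x.1 \in [:: k0; k1], y.1 \in [:: k0; k1], freely_generates h &
      forall n, (n < N)%N -> U n (h (inl n))].
Proof.
move=> k01 fg EF dF nU.
(* Density is applied to the interior of [U n], so that [U n] is a neighbourhood of the chosen value
   and leaves room for a perturbation. *)
have Uf n : exists f : gword K,
    [/\ red f, eval_gword g f <> 1 & nbhs (eval_gword g f) (U n)].
  have [x Ux] := nU n.
  exact: (dense_free_word EF dF (nbhs_interior Ux)).
have [f0 f0P] := choice Uf.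
(* Beyond [N] a one-letter word is used, which keeps all lengths bounded; the successor in [L]
   accounts for it. *)
pose f n := if (n < N)%N then f0 n else [:: (k0, false)].
pose L := (\sum_(n < N) size (f0 n)).+1.
have fP n : [/\ red (f n), (size (f n) <= L)%N & eval_gword g (f n) <> 1].
  rewrite /f; case: ifP => nN; last first.
    by split=> //; apply: fg => //; apply/redP.
  have [rf f1 _] := f0P n; split=> //.
  by rewrite /L (bigD1 (Ordinal nN)) //=; lia.
(* [X] takes whichever of [k0] and [k1] is not the variable of [Y]. *)
pose X (b : bool) : K * bool := (if b then k0 else k1, false).
pose Y (b : bool * bool) : K * bool := (if b.1 then k1 else k0, b.2).
pose c b n := eval_gword g (conjugator (X b.1) (Y b) (spaced L n.+1)).
(* Since [y] depends on [w], the condition is imposed for all four candidates at once; it is a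
   finite intersection of neighbourhoods of 1. *)
have : \forall w \near nbhs (1 : G), forall p : 'I_N * (bool * bool),
    U p.1 (eval_gword g (f0 p.1) * c p.2 p.1 * w * (c p.2 p.1)^-1).
  apply: filter_forall => -[n b] /=; apply: continuous_conjg.
  by rewrite mulgK; have [] := f0P n.
move=> /(dense_free_word EF dF)[w [rw w1 Uw]].
have [|b yw] := @noncancelling_letter K k0 k1 w k01 rw.
  by move=> w0; rewrite w0 eval_nil in w1.
have xy : (X b.1).1 != (Y b).1 by rewrite /=; case: (b.1); rewrite // eq_sym.
have fh := free_family fg xy yw fP.
exists (X b.1), (Y b); eexists; split; [| |exact: fh|].
- by rewrite /=; case: (b.1); rewrite !inE eqxx ?orbT.
- by rewrite /=; case: (b.1); rewrite !inE eqxx ?orbT.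
- by move=> n nN; have := Uw (Ordinal nN, b); rewrite /= /f nN.
Qed.

(** * Density of the free tuples, according to the rank *)

Lemma dense_free_tuples_subsingleton (K : Type) (G : topologicalGroupType)
    (g : K -> G) (F : set G) (k : K) :
  (forall k k' : K, k = k') ->
  freely_generates g -> F = generated_subgroup (range g) -> dense (F `\ 1) ->
  dense (@free_tuples K G).
Proof.
move=> KK fg EF dF; apply: dense_free_tuples => A U /(_ k)[x Ux].
have [w [rw w1 Uw]] := @dense_free_word {classic K} G g F x (U k) EF dF Ux.
exists (fun=> eval_gword g w); last by move=> j _; rewrite (KK j k).
apply: (@free_subsingleton {classic K}) => // w0.
by rewrite w0 (@eval_nil {classic K}) in w1.
Qed.

Lemma dense_free_tuples_ge2 (K : Type) (G : topologicalGroupType) (g : K -> G)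
    (F : set G) (k0 k1 : K) :
  k0 <> k1 ->
  freely_generates g -> F = generated_subgroup (range g) -> dense (F `\ 1) ->
  dense (@free_tuples K G).
Proof.
move=> k01 fg EF dF; have {}k01 : (k0 : {classic K}) != k1 by exact/eqP.
apply: dense_free_tuples => A U nU.
(* Putting [k0] and [k1] among the constrained indices ensures that every index outside [A'] differs
   from [x.1] and [y.1]. *)
pose A' : seq {classic K} := [:: k0; k1] ++ A.
have [|x [y [h [xA yA fh Uh]]]] := @free_family_near {classic K} G g F k0 k1
    (size A') (fun n => U (nth (k0 : {classic K}) A' n)) k01 fg EF dF.
  by move=> n; exact: nU.
have out (k : {classic K}) : ~ (k \in A') -> (k != x.1) && (k != y.1).
  by move=> /negP kA; rewrite !(contraNneq _ kA) // => ->; rewrite mem_cat ?xA ?yA.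
(* A constrained index is sent to its position in [A'], any other to the adjoined generator it
   labels. *)
pose i (k : {classic K}) : nat + {k : {classic K} | (k != x.1) && (k != y.1)} :=
  match pselect (k \in A') with
  | left _ => inl (index k A')
  | right kA => inr (exist _ k (out k kA))
  end.
exists (h \o i).
  apply: freely_generates_comp fh => k k'.
  rewrite /i; case: pselect => kA; case: pselect => kA' //.
    by move=> [] /(congr1 (nth (k0 : {classic K}) A')); rewrite !nth_index.
  by move=> [].
move=> k kA; have kA' : k \in A' by rewrite mem_cat kA orbT.
rewrite /i /=; case: pselect => [_|//].
by have := Uh (index k A'); rewrite index_mem nth_index //; apply.
Qed.

Lemma dense_free_tuples_nat (K : Type) (G : topologicalGroupType) (g : K -> G)
    (F : set G) (k0 k1 : K) :
  k0 <> k1 ->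
  freely_generates g -> F = generated_subgroup (range g) -> dense (F `\ 1) ->
  dense (@free_tuples nat G).
Proof.
move=> k01 fg EF dF; have {}k01 : (k0 : {classic K}) != k1 by exact/eqP.
apply: dense_free_tuples => A U nU.
(* The bound exceeds every index in [A], so all constraints are met by the family [inl]. *)
have [x [y [h [_ _ fh Uh]]]] := @free_family_near {classic K} G g F k0 k1
    (\max_(j <- A) (j : nat)).+1 U k01 fg EF dF nU.
exists (h \o inl); first by apply: freely_generates_comp fh => n m [].
move=> n nA; apply: Uh.
by rewrite ltnS (@leq_bigmax_seq {classic nat} A xpredT (fun j => j)).
Qed.

Theorem theorem13 (G : topologicalGroupType) (K : Type) (F : set G) :
  [set: K] !=set0 ->
  is_free_subgroup_of_rank K F ->
  dense (F `\ 1) ->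
  almost_free K G /\
  ((`I_2 #<= [set: K])%card -> ([set: K] #<= [set: nat])%card ->
    almost_countably_free G).
Proof.
move=> [k0 _] [g fg EF] dF.
have infG : infinite_set [set: G] := @free_infinite {classic K} G g k0 fg.
have [[k1 k01]|all_eq] := pselect (exists k1, k0 <> k1).
  split; first by split=> //; exact: dense_free_tuples_ge2 k01 fg EF dF.
  by split=> //; exact: dense_free_tuples_nat k01 fg EF dF.
have KK (k k' : K) : k = k'.
  have eq0 k1 : k0 = k1 by apply: contrapT => k01; apply: all_eq; exists k1.
  by rewrite -(eq0 k) -(eq0 k').
split; first by split=> //; exact: (dense_free_tuples_subsingleton k0 KK fg EF dF).
(* For one-element [K] the second claim is vacuous, since two elements do not embed in [K]. *)
have -> : [set: K] = [set k0] by apply/seteqP; split=> k _ //; exact: KK.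
by rewrite (card_le_eqr (@card_set1 _ k0)) card_le_II.
Qed.
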